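(* Let $\Bbbk$ be a field, $S=\Bbbk[x_1,\ldots,x_n]$, and let $I\subseteq S$ be a monomial ideal. If the LCM lattice $\mathcal{L}_I$ is lower semimodular and coatomic, then $\operatorname{pd}_S(S/I)=\operatorname{rank}(\mathcal{L}_I)$.
   Context: $\operatorname{pd}_S$ denotes projective dimension over $S$. The LCM lattice $\mathcal{L}_I$ of a monomial ideal $I$ is the set of least common multiples of subsets of its minimal monomial generators (the lcm of the empty set is $1$), ordered by divisibility; it is a finite lattice with join lcm. A finite lattice $L$ with bottom $\hat 0$ and top $\hat 1$ is graded if it has an order-preserving function $\operatorname{rk}:L\to\mathbb{Z}$ with $\operatorname{rk}(\hat 0)=0$ and $\operatorname{rk}(y)=\operatorname{rk}(x)+1$ whenever $y$ covers $x$; then $\operatorname{rank}(L)=\operatorname{rk}(\hat 1)$. $L$ is lower semimodular if it is graded and $\operatorname{rk}(x)+\operatorname{rk}(y)\le\operatorname{rk}(x\wedge y)+\operatorname{rk}(x\vee y)$ for all $x,y\in L$. A coatom is an element covered by $\hat 1$; $L$ is coatomic if every element is a (possibly empty) finite meet of coatoms. *)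

(* Defs.v *)
From HB Require Import structures.
From mathcomp Require Import all_boot all_order all_algebra.
From mathcomp Require Import generic_quotient ring_quotient.
From mathcomp Require Import mpoly boolp.

Set Implicit Arguments.
Unset Strict Implicit.
Unset Printing Implicit Defensive.

Import Order.TTheory GRing.Theory Num.Theory.
Local Open Scope quotient_scope.
Local Open Scope ring_scope.

(* [Quotient.quot] is only an abelian group; and it wants a [zmodClosed]
   predicate, which a submodule is by multiplication by -1. *)
Section QuotientModule.
Variables (R : pzRingType) (M : lmodType R) (N : submodClosed M).

Definition submod_pred : {pred M} := N.

Fact submod_pred_zmod_closed : zmod_closed submod_pred.
Proof.
split=> [|x y Nx Ny]; first exact: (rpred0 N).
by rewrite -[- y]scaleN1r; apply: (@rpredD _ N) => //; apply: (@rpredZ _ _ N).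
Qed.
HB.instance Definition _ :=
  GRing.isZmodClosed.Build M submod_pred submod_pred_zmod_closed.

Definition quot_module : Type := Quotient.quot submod_pred.

HB.instance Definition _ := GRing.Zmodule.on quot_module.

Definition quot_pi (x : M) : quot_module := \pi_(Quotient.quot submod_pred) x.

Definition quot_scale (a : R) (x : quot_module) : quot_module :=
  quot_pi (a *: repr x).

Lemma quot_piK (x : quot_module) : quot_pi (repr x) = x.
Proof. exact: reprK. Qed.

Lemma eq_quot_pi x y : (quot_pi x == quot_pi y) = (x - y \in N).
Proof. by rewrite -[LHS]Quotient.idealrBE. Qed.

Lemma quot_piD x y : quot_pi (x + y) = quot_pi x + quot_pi y.
Proof. exact: Quotient.pi_add. Qed.

Lemma quot_piZ a x : quot_scale a (quot_pi x) = quot_pi (a *: x).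
Proof.
apply/eqP; rewrite /quot_scale eq_quot_pi -scalerBr.
by apply: (@rpredZ _ _ N); rewrite -eq_quot_pi quot_piK.
Qed.

Fact quot_scaleA a b x :
  quot_scale a (quot_scale b x) = quot_scale (a * b) x.
Proof. by rewrite {2}/quot_scale quot_piZ scalerA. Qed.

Fact quot_scale1 : left_id 1 quot_scale.
Proof. by move=> x; rewrite /quot_scale scale1r quot_piK. Qed.

Fact quot_scaleDr : right_distributive quot_scale +%R.
Proof.
move=> a x y; rewrite -[x]quot_piK -[y]quot_piK -quot_piD.
by rewrite !quot_piZ scalerDr quot_piD.
Qed.

Fact quot_scaleDl x : {morph quot_scale^~ x : a b / a + b}.
Proof. by move=> a b; rewrite /quot_scale scalerDl quot_piD. Qed.

HB.instance Definition _ := GRing.Zmodule_isLmodule.Build R quot_module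
  quot_scaleA quot_scale1 quot_scaleDr quot_scaleDl.

Fact quot_pi_is_linear : linear quot_pi.
Proof. by move=> a x y; rewrite quot_piD -quot_piZ. Qed.
HB.instance Definition _ :=
  GRing.isLinear.Build R M quot_module *:%R quot_pi quot_pi_is_linear.
End QuotientModule.

Section ProjectiveDimension.
Variable R : pzRingType.

Definition projective (P : lmodType R) : Prop :=
  forall (M N : lmodType R) (g : {linear M -> N}) (f : {linear P -> N}),
    (forall y, exists x, g x = y) ->
    exists h : {linear P -> M}, forall x, g (h x) = f x.

(* 0 -> P_l -> ... -> P_1 -> P_0 -> M -> 0, continued by zero modules. *)
Definition has_projective_resolution (M : lmodType R) (l : nat) : Prop :=
  exists (P : nat -> lmodType R) (eps : {linear P 0%N -> M})
         (d : forall i, {linear P i.+1 -> P i}),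
    [/\ forall i, projective (P i),
        forall i, (l < i)%N -> forall x : P i, x = 0,
        forall y, exists x, eps x = y,
        forall x, eps x = 0 <-> exists y, d 0%N y = x
      & forall i (x : P i.+1), d i x = 0 <-> exists y, d i.+1 y = x].

(* The least length of a projective resolution, [None] standing for infinity.
   With this convention the zero module has projective dimension 0. *)
Definition proj_dim (M : lmodType R) : option nat :=
  if pselect (exists l, `[< has_projective_resolution M l >]) is left ex
  then Some (ex_minn ex) else None.

End ProjectiveDimension.

Section FiniteLattices.
Context {disp : Order.disp_t}.
Variable L : finTBLatticeType disp.
Implicit Types (x y : L) (rk : L -> int).

Definition covers y x : bool := (x < y)%O && [forall z : L, ~~ (x < z < y)%O].

Definition coatom x : bool := covers \top%O x.

Definition coatomic : Prop :=
  forall x, exists2 A : {set L},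
    {in A, forall c, coatom c} & x = \big[Order.meet / \top%O]_(c in A) c.

Definition is_rank_function rk : Prop :=
  [/\ {homo rk : x y / (x <= y)%O >-> x <= y},
      rk \bot%O = 0 & forall x y, covers y x -> rk y = rk x + 1].

Definition graded : Prop := exists rk, is_rank_function rk.

(* 0 if [L] is not graded; [lattice_rankE] shows that the choice of the rank
   function is immaterial. *)
Definition lattice_rank : int :=
  if pselect graded is left gr then projT1 (cid gr) \top%O else 0.

Definition lower_semimodular : Prop :=
  exists2 rk, is_rank_function rk &
    forall x y, rk x + rk y <= rk (Order.meet x y) + rk (Order.join x y).

Lemma exists_covered x : x != \bot%O -> exists y, covers x y.
Proof.
move=> x0; have lt0x : (\bot < x)%O by rewrite lt0x.
pose h y := #|[set z : L | (z <= y)%O]|.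
case: (@arg_maxnP _ (\bot%O : L) (fun y => y < x)%O h) => // y ltyx ymax.
exists y; rewrite /covers ltyx; apply/forallP=> z; apply/negP=> /andP[yz zx].
have /= := ymax z zx; rewrite /geq /h /= leqNgt => /negP; apply.
apply: proper_card; apply/properP; split; last first.
  by exists z; rewrite !inE ?lexx // lt_geF.
by apply/subsetP=> t; rewrite !inE => ty; apply: le_trans ty (ltW yz).
Qed.

Lemma rank_function_unique rk rk' :
  is_rank_function rk -> is_rank_function rk' -> rk =1 rk'.
Proof.
move=> [_ rk0 rkS] [_ rk'0 rk'S] x.
have [m] := ubnP #|[set z : L | (z < x)%O]|; elim: m x => // m IH x lem.
have [->|/exists_covered [y cxy]] := eqVneq x \bot%O; first by rewrite rk0 rk'0.
rewrite (rkS y x) // (rk'S y x) // (IH y) //; have /andP[yx _] := cxy.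
suff /leq_trans : (#|[set z : L | (z < y)%O]| < #|[set z : L | (z < x)%O]|)%N.
  by apply.
apply: proper_card; apply/properP; split; last by exists y; rewrite !inE ?ltxx.
by apply/subsetP=> t; rewrite !inE => ty; apply: lt_trans ty yx.
Qed.

Lemma lattice_rankE rk : is_rank_function rk -> lattice_rank = rk \top%O.
Proof.
move=> rkP; rewrite /lattice_rank; case: pselect => [gr|[]]; last by exists rk.
by apply: rank_function_unique => //; apply: (projT2 (cid gr)).
Qed.

End FiniteLattices.

Fact mlcmA n : associative (@mlcm n).
Proof. by move=> m1 m2 m3; apply/mnmP=> i; rewrite !mnmE maxnA. Qed.
HB.instance Definition _ n := Monoid.isComLaw.Build 'X_{1..n} 0%MM (@mlcm n)
  (@mlcmA n) (@mlcmC n) (@mlc0m n).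

Fact lcm_display : Order.disp_t. Proof. exact: Order.Disp tt tt. Qed.

Section LcmLattice.
Variables (n : nat) (G : seq 'X_{1..n}).
Implicit Types (A : {set seq_sub G}) (m : 'X_{1..n}).

Definition lcm_of A : 'X_{1..n} := \big[@mlcm n/0%MM]_(g in A) ssval g.

Definition lcm_lattice : Type := seq_sub (codom lcm_of).
HB.instance Definition _ := Finite.on lcm_lattice.

Implicit Types x y z : lcm_lattice.

Lemma lem_lcm_of A m :
  (lcm_of A <= m)%MM = [forall g in A, (ssval g <= m)%MM].
Proof.
rewrite /lcm_of; transitivity (all (fun g => ssval g <= m)%MM (enum A)).
  rewrite -big_enum; elim: (enum A) => [|g s IH].
    by rewrite big_nil; apply/mnm_lepP=> i; rewrite mnm0E.
  by rewrite big_cons lem_mlcm IH.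
apply/allP/forall_inP => H g; first by rewrite -mem_enum; apply: H.
by rewrite mem_enum; apply: H.
Qed.

Definition lcm_elt A : lcm_lattice := SeqSub (codom_f lcm_of A).

Lemma lcm_eltP x : exists A, x = lcm_elt A.
Proof. by case: x => m mG; have /codomP[A E] := mG; exists A; apply: val_inj. Qed.

Definition lcm_le x y : bool := (ssval x <= ssval y)%MM.

Fact lcm_le_refl : reflexive lcm_le. Proof. by move=> x; apply: lepm_refl. Qed.

Fact lcm_le_anti : antisymmetric lcm_le.
Proof.
move=> x y /andP[/mnm_lepP xy /mnm_lepP yx]; apply/val_inj/mnmP=> i.
by apply/eqP; rewrite eqn_leq xy yx.
Qed.

Fact lcm_le_trans : transitive lcm_le.
Proof. by move=> y x z; apply: lepm_trans. Qed.

HB.instance Definition _ := Order.Le_isPOrder.Build lcm_display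
  lcm_lattice lcm_le_refl lcm_le_anti lcm_le_trans.

Definition lcm_meet x y : lcm_lattice :=
  lcm_elt [set g | (ssval g <= ssval x)%MM && (ssval g <= ssval y)%MM].

Fact lcm_meetP x y z : (x <= lcm_meet y z)%O = (x <= y)%O && (x <= z)%O.
Proof.
rewrite {1}/lcm_meet; set A := [set g | _].
apply/idP/andP => [le_x|[]].
  split; apply: (le_trans le_x); rewrite /Order.le /= /lcm_le lem_lcm_of;
    by apply/forall_inP=> g; rewrite inE => /andP[].
have [B ->] := lcm_eltP x; rewrite /Order.le /= /lcm_le /= !lem_lcm_of.
move=> /forall_inP By /forall_inP Bz; apply/forall_inP=> g gB.
have := lepm_refl (lcm_of A); rewrite lem_lcm_of => /forall_inP; apply.
by rewrite inE By ?Bz.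
Qed.

Fact lcm_join_subproof x y : mlcm (ssval x) (ssval y) \in codom lcm_of.
Proof.
have [A ->] := lcm_eltP x; have [B ->] := lcm_eltP y => /=.
apply/codomP; exists (A :|: B).
suff E m : (mlcm (lcm_of A) (lcm_of B) <= m)%MM = (lcm_of (A :|: B) <= m)%MM.
  apply/mnmP=> i; apply/eqP; rewrite eqn_leq.
  have /mnm_lepP -> : (mlcm (lcm_of A) (lcm_of B) <= lcm_of (A :|: B))%MM.
    by rewrite E lepm_refl.
  have /mnm_lepP -> // : (lcm_of (A :|: B) <= mlcm (lcm_of A) (lcm_of B))%MM.
  by rewrite -E lepm_refl.
rewrite lem_mlcm !lem_lcm_of.
apply/andP/forall_inP => [[/forall_inP hA /forall_inP hB] g|H].
  by rewrite inE => /orP[/hA|/hB].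
by split; apply/forall_inP=> g gAB; apply: H; rewrite inE gAB ?orbT.
Qed.

Definition lcm_join x y : lcm_lattice := SeqSub (lcm_join_subproof x y).

Fact lcm_joinP x y z : (lcm_join x y <= z)%O = (x <= z)%O && (y <= z)%O.
Proof. exact: lem_mlcm. Qed.

HB.instance Definition _ := Order.POrder_MeetJoin_isLattice.Build
  lcm_display lcm_lattice lcm_meetP lcm_joinP.

Fact lcm_bottomP x : (lcm_elt set0 <= x)%O.
Proof.
by rewrite /Order.le /= /lcm_le lem_lcm_of; apply/forall_inP=> g; rewrite inE.
Qed.

Fact lcm_topP x : (x <= lcm_elt setT)%O.
Proof.
have [A ->] := lcm_eltP x; rewrite /Order.le /= /lcm_le lem_lcm_of.
apply/forall_inP=> g _ /=.
have := lepm_refl (lcm_of setT); rewrite lem_lcm_of => /forall_inP; apply.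
by rewrite inE.
Qed.

HB.instance Definition _ := Order.hasBottom.Build
  lcm_display lcm_lattice lcm_bottomP.
HB.instance Definition _ := Order.hasTop.Build
  lcm_display lcm_lattice lcm_topP.

End LcmLattice.

Lemma dickson_lemma n (P : n.-tuple nat -> Prop) :
  exists2 s : seq (n.-tuple nat), (forall t, t \in s -> P t) &
    forall t, P t -> exists2 u, u \in s & forall i, (tnth u i <= tnth t i)%N.
Proof.
elim: n P => [|n IH] P.
  have [P0|nP0] := pselect (P [tuple]).
    exists [:: [tuple]] => [t|t _]; first by rewrite inE => /eqP ->.
    by exists [tuple]; rewrite ?inE // => -[].
  by exists [::] => // t; rewrite (tuple0 t).
have [s sP sB] := IH (fun t => exists h, P [tuple of h :: t]).
have [u uP [b ub]] : exists2 u : seq (n.+1.-tuple nat),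
    (forall t, t \in u -> P t) & exists b, forall t, t \in s ->
      exists2 h, (h <= b)%N & [tuple of h :: t] \in u.
  elim: s sP {sB} => [|t s IHs] sP; first by exists [::] => //; exists 0%N.
  have [|u uP [b ub]] := IHs; first by move=> v vs; apply: sP; rewrite inE vs orbT.
  have [|h Ph] := sP t; first by rewrite inE eqxx.
  exists ([tuple of h :: t] :: u).
    by move=> v; rewrite inE => /orP[/eqP ->|/uP].
  exists (maxn h b) => v; rewrite inE => /orP[/eqP ->|/ub [h' lh' uh']].
    by exists h; rewrite ?leq_maxl // inE eqxx.
  by exists h'; rewrite ?inE ?uh' ?orbT // leq_max lh' orbT.
have [w wP wB] : exists2 w : seq (n.+1.-tuple nat), (forall t, t \in w -> P t) &
    forall (h : nat) (t : n.-tuple nat), (h < b)%N -> P [tuple of h :: t] ->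
      exists2 v : n.-tuple nat, [tuple of h :: v] \in w &
        forall i, (tnth v i <= tnth t i)%N.
  elim: b {ub} => [|b [w wP wB]]; first by exists [::].
  have [r rP rB] := IH (fun t => P [tuple of b :: t]).
  exists ([seq [tuple of b :: tval t] | t : n.-tuple nat <- r] ++ w).
    by move=> t; rewrite mem_cat => /orP[/mapP[v /rP Pv ->]|/wP].
  move=> h t; rewrite ltnS leq_eqVlt => /orP[/eqP ->|ltb] Pt.
    have [v vr le_v] := rB t Pt; exists v => //.
    by rewrite mem_cat (map_f (fun t : n.-tuple nat => [tuple of b :: t])).
  by have [v vw le_v] := wB h t ltb Pt; exists v => //; rewrite mem_cat vw orbT.
exists (u ++ w) => [t|t Pt].
  by rewrite mem_cat => /orP[/uP|/wP].
have Et : t = [tuple of thead t :: behead_tuple t] by exact: tuple_eta.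
have le_cons (h h' : nat) (v v' : n.-tuple nat) : (h <= h')%N ->
    (forall i, (tnth v i <= tnth v' i)%N) ->
    forall i, (tnth [tuple of h :: v] i <= tnth [tuple of h' :: v'] i)%N.
  move=> hh vv i; case: (unliftP ord0 i) => [j ->|->]; last by rewrite !tnth0.
  by rewrite !tnthS.
have [ltb|geb] := ltnP (thead t) b.
  have [|v vw le_v] := wB (thead t) (behead_tuple t) ltb; first by rewrite -Et.
  exists [tuple of thead t :: v]; first by rewrite mem_cat vw orbT.
  move=> i; have := le_cons _ _ _ _ (leqnn (thead t)) le_v i; by rewrite -Et.
have [|v vs le_v] := sB (behead_tuple t); first by exists (thead t); rewrite -Et.
have [h hb hu] := ub v vs; exists [tuple of h :: v]; first by rewrite mem_cat hu.
by move=> i; have := le_cons _ _ _ _ (leq_trans hb geb) le_v i; rewrite -Et.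
Qed.

Section MonomialIdeals.
Variables (k : fieldType) (n : nat).
Local Notation S := {mpoly k[n]}.
(* Ideals of [S] are the submodules of [S^o]; unlike [idealr], this includes
   the unit ideal. *)
Variable I : submodClosed S^o.

Definition monomial_ideal : Prop :=
  exists G : 'X_{1..n} -> Prop, forall p : S, p \in I <->
    exists2 s : seq (S * 'X_{1..n}),
      {in s, forall c, G c.2} & p = \sum_(c <- s) c.1 * 'X_[c.2].

Definition min_generator (m : 'X_{1..n}) : Prop :=
  'X_[m] \in I /\ forall m', ('X_[m'] : S) \in I -> (m' <= m)%MM -> m' = m.

Lemma min_generators_finite :
  exists s : seq 'X_{1..n}, forall m, m \in s <-> min_generator m.
Proof.
have [s sP sB] := dickson_lemma
  (fun t : n.-tuple nat => ('X_[Multinom t] : S) \in I).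
exists [seq m <- map (@Multinom n) s | `[< min_generator m >]] => m.
rewrite mem_filter; split=> [/andP[/asboolP]//|mP].
apply/andP; split; first exact/asboolP.
have [u us le_u] := sB m ltac:(by case: mP; case: (m)).
suff -> : m = Multinom u by apply: map_f.
apply/esym/(proj2 mP); first exact: sP.
by apply/mnm_lepP=> i; have := le_u i; rewrite -!mnm_tnth.
Qed.

Definition min_generators : seq 'X_{1..n} := projT1 (cid min_generators_finite).

Lemma mem_min_generators m : m \in min_generators <-> min_generator m.
Proof. exact: (projT2 (cid min_generators_finite)). Qed.

Definition LCM_lattice := lcm_lattice min_generators.

HB.instance Definition _ := Order.FinTBLattice.on LCM_lattice.
End MonomialIdeals.

(* Main.v *)
Require Import Defs.
From HB Require Import structures.
From mathcomp Require Import all_boot all_order all_algebra.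
From mathcomp Require Import fingroup perm generic_quotient.
From mathcomp Require Import mpoly ssrcomplements.
From mathcomp Require Import boolp lra zify.

(* The chains p_1 > ... > p_i > 1 of the LCM lattice L label the basis of a free
   resolution of S/I whose differential is the simplicial boundary, the chain
   carrying the multidegree p_1: in multidegree m, putting the largest element
   of L that divides m on top of a chain is a contracting homotopy. A rank
   function bounds the length of chains, so pd(S/I) <= rank(L) =: r.

   Comparing this resolution with a projective resolution of length < r would
   split its last differential. To exclude this, choose coatoms c_1, ..., c_r
   whose meets over subsets A have rank r - |A|; semimodularity and coatomicity
   yield them greedily. Each permutation s gives the maximal chain of the meets
   of c_s(1), ..., c_s(t). In the boundary of the signed sum z of these chains
   all faces cancel in pairs, except those omitting the top, which come with a
   nontrivial monomial. Hence dz lies in the maximal homogeneous ideal times the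
   free module, whereas z has a coefficient 1, so d does not split. *)

Set Implicit Arguments.
Unset Strict Implicit.
Unset Printing Implicit Defensive.

Import Order.TTheory GRing.Theory Num.Theory.
Local Open Scope ring_scope.

(** * Comparison of projective resolutions *)

Section Kernel.
Context {R : pzRingType} {A B : lmodType R}.
Variable g : {linear A -> B}.

Definition ker_pred : {pred A} := [pred a | g a == 0].

Fact ker_pred_submod : submod_closed ker_pred.
Proof.
split=> [|c x y]; first by rewrite inE linear0.
by rewrite !inE linearP => /eqP-> /eqP->; rewrite scaler0 addr0.
Qed.

HB.instance Definition _ := GRing.isSubmodClosed.Build R A
  ker_pred ker_pred_submod.

End Kernel.

Section Projective.
Context {R : pzRingType}.

(* The image of [g] is presented as [A / ker g]. *)
Lemma projective_lift (P A B : lmodType R) (g : {linear A -> B})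
    (f : {linear P -> B}) :
  projective P -> (forall x, exists a, g a = f x) ->
  exists h : {linear P -> A}, forall x, g (h x) = f x.
Proof.
move=> projP fg; have [r rP] := choice fg.
have eqpi a b : g a = g b -> quot_pi (ker_pred g) a = quot_pi (ker_pred g) b.
  by move=> gab; apply/eqP; rewrite eq_quot_pi inE linearB gab subrr.
pose q x := quot_pi (ker_pred g) (r x).
have qlin : linear q.
  by move=> c x y; rewrite /q -linearP; apply: eqpi; rewrite linearP !rP linearP.
pose qL := HB.pack_for {linear P -> quot_module (ker_pred g)} q
  (GRing.isLinear.Build R P (quot_module (ker_pred g)) *:%R q qlin).
have [|h hP] := projP _ _ (quot_pi (ker_pred g) : {linear _ -> _}) qL.
  by move=> y; exists (repr y); exact: quot_piK.
exists h => x; have /eqP := hP x.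
by rewrite /= /q eq_quot_pi inE linearB rP subr_eq0 => /eqP.
Qed.

Section FreeExtension.
Context {T : finType} {V : lmodType R}.
Variable u : T -> V.

Definition free_ext (x : {ffun T -> R^o}) : V := \sum_t (x t : R) *: u t.

Fact free_ext_linear : linear free_ext.
Proof.
move=> c x y; rewrite /free_ext scaler_sumr -big_split; apply: eq_bigr => t _.
by rewrite !ffunE scalerDl scalerA.
Qed.

HB.instance Definition _ := GRing.isLinear.Build R {ffun T -> R^o} V *:%R
  free_ext free_ext_linear.
End FreeExtension.

Definition free_delta {T : finType} (t : T) : {ffun T -> R^o} :=
  [ffun t' => (t' == t)%:R].

Lemma free_deltaE (T : finType) (x : {ffun T -> R^o}) :
  x = \sum_t (x t : R) *: free_delta t.
Proof.
apply/ffunP=> t; rewrite sum_ffunE (bigD1 t) //= !ffunE eqxx big1 ?addr0.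
  by rewrite [_ *: _]mulr1.
by move=> s st; rewrite !ffunE eq_sym (negPf st) scaler0.
Qed.

Lemma free_ext_delta (T : finType) (V : lmodType R) (u : T -> V) t :
  free_ext u (free_delta t) = u t.
Proof.
rewrite /free_ext (bigD1 t) //= ffunE eqxx scale1r big1 ?addr0 // => s st.
by rewrite ffunE (negPf st) scale0r.
Qed.

Lemma projective_free (T : finType) : projective {ffun T -> R^o}.
Proof.
move=> M N g f gsurj; have [u uP] := choice (fun t => gsurj (f (free_delta t))).
exists (free_ext u) => x /=.
rewrite [in RHS](free_deltaE x) !linear_sum /=; apply: eq_bigr => t _.
by rewrite !linearZ /= uP.
Qed.

(* Two projective resolutions of [M] are homotopy equivalent; if one of them
   stops before degree [j.+1] while the other one has an injective
   differential there, then this differential splits. *)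
Lemma differential_split (M : lmodType R) (F P : nat -> lmodType R)
    (epsF : {linear F 0%N -> M}) (dF : forall i, {linear F i.+1 -> F i})
    (epsP : {linear P 0%N -> M}) (dP : forall i, {linear P i.+1 -> P i}) (j : nat) :
    (forall i, projective (F i)) -> (forall i, projective (P i)) ->
    (forall y, exists x, epsF x = y) -> (forall y, exists x, epsP x = y) ->
    (forall x, epsF x = 0 <-> exists y, dF 0%N y = x) ->
    (forall x, epsP x = 0 <-> exists y, dP 0%N y = x) ->
    (forall i x, dF i x = 0 <-> exists y, dF i.+1 y = x) ->
    (forall i x, dP i x = 0 <-> exists y, dP i.+1 y = x) ->
    (forall x : P j.+1, x = 0) -> injective (dF j) ->
  exists s : {linear F j -> F j.+1}, forall y, s (dF j y) = y.
Proof.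
move=> projF projP surjF surjP exF0 exP0 exF exP Pj0 injF.
have dFd i y : dF i (dF i.+1 y) = 0 by apply/exF; exists y.
have dPd i y : dP i (dP i.+1 y) = 0 by apply/exP; exists y.
(* [a] and [b] are the degree [j] parts of comparison maps, and [s] belongs to a homotopy between
   [b \o a] and the identity. As [P j.+1] is zero, [a] kills the image of [dF j], so
   [dF j \o s \o dF j] is [- dF j], and [- s] splits the injective [dF j]. *)
suff [a [b [s [aP _ sP]]]] : exists (a : {linear F j -> P j})
    (b : {linear P j -> F j}) (s : {linear F j -> F j.+1}),
    [/\ forall y, exists z, a (dF j y) = dP j z,
        forall y, exists z, b (dP j y) = dF j z
      & forall y, dF j (s (dF j y)) = b (a (dF j y)) - dF j y].
  exists (\- s : {linear _ -> _}) => y /=.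
  apply: injF; rewrite linearN sP; have [z ->] := aP y.
  by rewrite (Pj0 z) !linear0 sub0r opprK.
have liftF i (A B : lmodType R) (g : {linear A -> B}) (f : {linear F i -> B}) :=
  @projective_lift _ A B g f (projF i).
have liftP i (A B : lmodType R) (g : {linear A -> B}) (f : {linear P i -> B}) :=
  @projective_lift _ A B g f (projP i).
elim: j {Pj0 injF} => [|j [a [b [s [aP bP sP]]]]].
  have [a aP] := liftF 0%N _ _ epsP epsF (fun x => surjP (epsF x)).
  have [b bP] := liftP 0%N _ _ epsF epsP (fun x => surjF (epsP x)).
  have [|s sP] := liftF 0%N _ _ (dF 0%N) (b \o a \- idfun : {linear _ -> _}).
    by move=> x /=; apply/exF0; rewrite linearB /= bP aP subrr.
  exists a, b, s; split=> y; last by rewrite sP.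
  - have /exP0[z <-] : epsP (a (dF 0%N y)) = 0 by rewrite aP; apply/exF0; exists y.
    by exists z.
  - have /exF0[z <-] : epsF (b (dP 0%N y)) = 0 by rewrite bP; apply/exP0; exists y.
    by exists z.
have [|a' a'P] := liftF j.+1 _ _ (dP j) (a \o dF j : {linear _ -> _}).
  by move=> x; have [z] := aP x; exists z.
have [|b' b'P] := liftP j.+1 _ _ (dF j) (b \o dP j : {linear _ -> _}).
  by move=> x; have [z] := bP x; exists z.
rewrite /= in a'P b'P.
have [|s' s'P] := liftF j.+1 _ _ (dF j.+1)
    ((b' \o a' \- idfun) \- (s \o dF j) : {linear _ -> _}).
  by move=> x /=; apply/exF; rewrite !linearB /= b'P a'P sP subrr.
exists a', b', s'; split=> y.
- have /exP[z <-] : dP j (a' (dF j.+1 y)) = 0 by rewrite a'P dFd linear0.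
  by exists z.
- have /exF[z <-] : dF j (b' (dP j.+1 y)) = 0 by rewrite b'P dPd linear0.
  by exists z.
- by rewrite s'P /= dFd linear0 subr0.
Qed.
End Projective.

(** * Chains and coatoms of lower semimodular lattices *)

Definition del {T : Type} (j : nat) (s : seq T) : seq T := take j s ++ drop j.+1 s.

Lemma size_del (T : Type) j (s : seq T) :
  (j < size s)%N -> size (del j s) = (size s).-1.
Proof. by move=> js; rewrite size_cat size_take size_drop js; lia. Qed.

Lemma del_mkseq (T : Type) (f g : nat -> T) j n :
  (forall i, (i < n)%N -> i != j -> f i = g i) ->
  del j (mkseq f n) = del j (mkseq g n).
Proof.
move=> fg; rewrite /del; congr (_ ++ _).
  apply: (@eq_from_nth _ (f 0%N)) => [|i]; rewrite !size_take ?size_mkseq //.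
  move=> ij; have [ij' ilt] : (i < j)%N /\ (i < n)%N by move: ij; case: ifP; lia.
  by rewrite !nth_take // !nth_mkseq // fg //; lia.
apply: (@eq_from_nth _ (f 0%N)) => [|i]; rewrite !size_drop ?size_mkseq // => ij.
by rewrite !nth_drop !nth_mkseq ?fg //; lia.
Qed.

Lemma del_cons0 (T : Type) (x : T) s : del 0 (x :: s) = s.
Proof. by rewrite /del /= drop0. Qed.

Lemma del_consS (T : Type) (x : T) j s : del j.+1 (x :: s) = x :: del j s.
Proof. by []. Qed.

Lemma del_subseq (T : eqType) j (s : seq T) : subseq (del j s) s.
Proof.
rewrite -[in X in subseq _ X](cat_take_drop j s) cat_subseq //.
by rewrite -addn1 addnC -drop_drop drop_subseq.
Qed.

(** Removing the head first or second gives the same terms with opposite signs. The double deletions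
    that keep the head [x] form the sum for the tail and [fun u => f (x :: u)], which is zero by
    induction. *)
Lemma boundary_boundary (R : pzRingType) (V : lmodType R) (T : Type)
    (f : seq T -> V) m (s : seq T) : size s = m.+1 ->
  \sum_(j < m.+1) (-1) ^+ j *: \sum_(l < m) (-1) ^+ l *: f (del l (del j s)) = 0.
Proof.
elim: m s f => [|m IH] [|x s] // f [ss].
  by apply: big1 => j _; rewrite big_ord0 scaler0.
rewrite big_ord_recl expr0 scale1r del_cons0.
under [X in _ + X]eq_bigr => j _.
  rewrite /= del_consS big_ord_recl expr0 scale1r del_cons0 scalerDr exprS mulN1r scaleNr.
  under eq_bigr => l _ do rewrite /= del_consS exprS mulN1r scaleNr.
  rewrite sumrN scaleNr scalerN opprK.
  over.
by rewrite big_split sumrN /= (IH s (fun u => f (x :: u))) // addr0 subrr.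
Qed.

Section Chains.
Context {disp : Order.disp_t} {L : finTBLatticeType disp}.
Implicit Types (x y : L) (s : seq L).

(** The largest entry comes first; appending [\bot] keeps it out of [s] itself. *)
Definition chain s : bool := sorted (fun x y => y < x)%O (rcons s \bot%O).

Lemma chain_cons x s : chain (x :: s) = (head \bot%O s < x)%O && chain s.
Proof. by case: s. Qed.

Lemma le_head_del x j s :
  chain (x :: s) -> (head \bot (del j (x :: s)) <= x)%O.
Proof.
by rewrite chain_cons => /andP[/ltW xs _]; case: j => [|j]; rewrite /del /= ?drop0.
Qed.

Lemma chain_del j s :
  chain s -> chain (del j s).
Proof.
apply: subseq_sorted; first by move=> x y z xy yz; apply: lt_trans yz xy.
by rewrite -!cats1 cat_subseq // del_subseq.
Qed.

Variable rk : L -> int.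
Hypothesis rkP : is_rank_function rk.

(** Among the elements that are at least [x] and strictly below [y], one with the largest down-set
    is covered by [y]. *)
Lemma rank_lt x y : (x < y)%O -> rk x + 1 <= rk y.
Proof.
have [mono _ step] := rkP => xy.
pose h y := #|[set z : L | (z <= y)%O]|.
have [|z /andP[xz zy] zmax] := @arg_maxnP _ x (fun z => (x <= z) && (z < y))%O h.
  by rewrite lexx.
rewrite (step z y) ?lerD2r ?mono // /covers zy; apply/forallP=> w.
apply/negP=> /andP[zw wy]; have /= := zmax w; rewrite (le_trans xz (ltW zw)) wy.
move=> /(_ isT); rewrite leqNgt => /negP; apply.
apply: proper_card; apply/properP; split; last first.
  by exists w; rewrite !inE ?lexx // lt_geF.
by apply/subsetP=> t; rewrite !inE => tz; apply: le_trans tz (ltW zw).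
Qed.

Lemma rank_ge0 x : 0 <= rk x.
Proof. by have [mono <- _] := rkP; apply/mono/le0x. Qed.

Lemma rank_eq0 x : rk x = 0 -> x = \bot%O.
Proof.
move=> rx; apply/eqP/negPn/negP; rewrite -lt0x => /rank_lt.
have := rank_ge0 (\bot%O : L); rewrite rx. lra.
Qed.

Lemma size_chain s : chain s -> (size s)%:Z <= rk (head \bot%O s).
Proof.
elim: s => [|x s IH] /=; first by rewrite rank_ge0.
by rewrite chain_cons => /andP[/rank_lt xs /IH]; lia.
Qed.

Hypothesis rk_sm : forall x y, rk x + rk y <= rk (Order.meet x y) + rk (Order.join x y).

(** If [x] is not below [c], their join is [\top], of rank [rk c + 1], and semimodularity leaves a
    loss of at most one. *)
Lemma rank_meet_coatom x c : coatom c -> rk x - 1 <= rk (Order.meet x c).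
Proof.
have [_ _ step] := rkP => cc; have /andP[ct /forallP nc] := cc.
have [/meet_idPl ->|xc] := boolP (x <= c)%O; first lia.
suff jt : Order.join x c = \top%O.
  by have := rk_sm x c; rewrite jt (step c \top%O) //; lra.
have := nc (Order.join x c); rewrite lt_neqAle leUr andbT eq_sym eq_joinr xc /=.
by rewrite ltx1 negbK => /eqP.
Qed.

Lemma rank_meets_coatoms x s : {in s, forall c, coatom c} ->
  rk x - (size s)%:Z <= rk (Order.meet x (\meet_(c <- s) c)%O).
Proof.
elim: s x => [|c s IH] x sP; first by rewrite big_nil meetx1 /=; lra.
rewrite big_cons meetA /=; have := rank_meet_coatom x (sP c (mem_head c s)).
have := IH (Order.meet x c) (fun d ds => sP d (@mem_behead _ (c :: s) d ds)).
by rewrite intS; lra.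
Qed.

Hypothesis coL : coatomic L.

(** While the meet is not [\bot], coatomicity gives a coatom that is not above it. Adding this
    coatom lowers the rank, and by exactly one. *)
Lemma exists_coatoms m : m%:Z <= rk \top%O -> exists s : seq L,
  [/\ {in s, forall c, coatom c}, size s = m &
      rk (\meet_(c <- s) c)%O = rk \top%O - m%:Z].
Proof.
elim: m => [|m IH] ltm; first by exists [::]; rewrite big_nil subr0.
have [|s [sP ss rs]] := IH; first by move: ltm; rewrite intS; lra.
have [A AP A0] := coL \bot%O.
have [c cA nsc] : exists2 c, c \in A & ~~ (\meet_(c <- s) c <= c)%O.
  apply/exists_inP; rewrite -negb_forall_in; apply/negP=> /forall_inP sA.
  have : (\meet_(c <- s) c <= \bot :> L)%O by rewrite A0; apply/meetsP.
  rewrite lex0 => /eqP s0; have [_ rk0 _] := rkP; move: ltm rs; rewrite s0 rk0 intS; lra.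
have cc := AP c cA; exists (c :: s); split=> /=; last 1 first.
- rewrite big_cons meetC intS.
  have lt : (Order.meet (\meet_(c <- s) c)%O c < \meet_(c <- s) c)%O.
    by rewrite lt_neqAle leIl andbT eq_meetl.
  have := rank_lt lt; have := rank_meet_coatom (\meet_(c <- s) c)%O cc; lra.
- by move=> d; rewrite inE => /orP[/eqP->|/sP].
- by rewrite ss.
Qed.

(** Each coatom lowers the rank by at most one, and all [r] of them together lower it by [r]. Hence
    meeting over [A] and then over its complement loses exactly one per coatom. *)
Lemma exists_coatom_basis : exists (r : nat) (c : 'I_r -> L),
  rk \top%O = r%:Z /\
  forall A : {set 'I_r}, rk (\meet_(i in A) c i)%O = r%:Z - #|A|%:Z.
Proof.
have rE : rk \top%O = `|rk \top%O|%N by rewrite gez0_abs // rank_ge0.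
have [|s [sP ss rs]] := @exists_coatoms `|rk \top%O|%N; first by rewrite -rE.
rewrite -rE subrr in rs; move: ss; set r := `|_|%N => ss.
have ltis (i : 'I_r) : (i < size s)%N by rewrite ss.
exists r, (fun i => nth \bot%O s i); split=> // A; rewrite -/r in rE.
have low x (B : {set 'I_r}) :
    rk x - #|B|%:Z <= rk (Order.meet x (\meet_(i in B) nth \bot%O s i)%O).
  have := @rank_meets_coatoms x [seq nth \bot%O s i | i : 'I_r <- enum B].
  rewrite size_map -cardE big_map big_enum; apply=> c /mapP[i _ ->].
  exact/sP/mem_nth.
have := low \top%O A; rewrite meet1x rE => lowA.
have := low (\meet_(i in A) nth \bot%O s i)%O (~: A).
suff -> : Order.meet (\meet_(i in A) nth \bot%O s i)%O
      (\meet_(i in ~: A) nth \bot%O s i)%O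
    = (\meet_(c <- s) c)%O.
  rewrite rs; have := cardsC A; rewrite card_ord => /(congr1 Posz); rewrite PoszD.
  by move=> cC; lra.
rewrite [RHS](big_nth \bot%O) ss big_mkord [RHS](bigID (mem A)) /=.
by apply: (congr1 (Order.meet _)); apply: eq_bigl => i; rewrite inE.
Qed.

(** * Maximal chains indexed by permutations of the coatoms *)

Section Flag.
Variables (r : nat) (c : 'I_r -> L).
Hypothesis rank_meets :
  forall A : {set 'I_r}, rk (\meet_(i in A) c i)%O = r%:Z - #|A|%:Z.

Definition flag_elt (s : {perm 'I_r}) (t : nat) : L :=
  (\meet_(i < r | (i < t)%N) c (s i))%O.

(** Index 0 gives the empty meet [\top]; index [r] would give [\bot], which chains omit. *)
Definition flag (s : {perm 'I_r}) : seq L := mkseq (flag_elt s) r.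

Lemma flag_eltE (s : {perm 'I_r}) t :
  flag_elt s t = (\meet_(i in [set s i | i : 'I_r & (i < t)%N]) c i)%O.
Proof.
rewrite big_imset /=; last by move=> i j _ _; apply: perm_inj.
by apply: eq_bigl => i; rewrite inE.
Qed.

Lemma rank_flag_elt (s : {perm 'I_r}) t : (t <= r)%N -> rk (flag_elt s t) = r%:Z - t%:Z.
Proof.
move=> tr; rewrite flag_eltE rank_meets card_imset; last exact: perm_inj.
by rewrite cardsE -sum1_card (big_ord_narrow tr) sum1_card card_ord.
Qed.

Lemma flag_eltr (s : {perm 'I_r}) : flag_elt s r = \bot%O.
Proof. by apply: rank_eq0; rewrite rank_flag_elt // subrr. Qed.

Lemma chain_flag (s : {perm 'I_r}) : chain (flag s).
Proof.
rewrite /chain -(flag_eltr s) -mkseqS; apply/(sortedP \bot%O) => t.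
rewrite size_mkseq => tr; rewrite !nth_mkseq ?(ltnW tr) // lt_neqAle.
apply/andP; split; last first.
  by apply/meetsP => i it; apply: meets_inf; apply: ltnW.
apply/eqP=> /(congr1 rk); rewrite !rank_flag_elt ?(ltnW tr) //; lia.
Qed.

(** Only the initial segment of length [j] separates the adjacent positions [i] and [j]. *)
Lemma flag_elt_tperm (s : {perm 'I_r}) t (i j : 'I_r) : i.+1 = j -> t != j :> nat ->
  flag_elt (tperm i j * s)%g t = flag_elt s t.
Proof.
move=> ij tj; rewrite /flag_elt [RHS](reindex_inj (@perm_inj _ (tperm i j))) /=.
apply: eq_big => [k|k _]; last by rewrite permM.
by case: tpermP => // ->; apply/idP/idP; lia.
Qed.

(** A meet over [A] lies below [c i] only when [i] is in [A], for otherwise adding [i] would lower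
    the rank. Equal flags thus force [s i <= i] for all [i], which only the identity satisfies. *)
Lemma flag_inj1 (s : {perm 'I_r}) : flag s = flag 1%g -> s = 1%g.
Proof.
move=> s1; have eqt t : (t <= r)%N -> flag_elt s t = flag_elt 1%g t.
  rewrite leq_eqVlt => /orP[/eqP->|tr]; first by rewrite !flag_eltr.
  by have := congr1 (fun u => nth \bot%O u t) s1; rewrite !nth_mkseq.
have le_s i : (s i <= i)%N.
  have : (flag_elt s i.+1 <= c (s i))%O by apply: meets_inf => /=.
  rewrite eqt // flag_eltE leEmeet.
  set A := [set _ | _ in _] => /eqP Ac.
  have [/imsetP[j]|nA] := boolP (s i \in A).
    by rewrite inE perm1 => ji ->.
  have := rank_meets (s i |: A); rewrite cardsU1 nA big_setU1 //= meetC Ac rank_meets.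
  by rewrite add1n => /addrI/oppr_inj[] /n_Sn.
apply/permP=> i; rewrite perm1; have [m] := ubnP i.
elim: m i => // m IH i im; apply/eqP/negPn/negP => si.
have lt : (s i < i)%N by rewrite ltn_neqAle le_s si.
have /perm_inj/eqP : s (s i) = s i by apply: IH; lia.
by rewrite (negPf si).
Qed.
End Flag.
End Chains.

(** * The chain resolution *)

(** Multiplication by the transposition matches odd with even permutations. Cancelling these pairs
    works in every characteristic, unlike showing that the sum is its own negative. *)
Lemma sum_perm_sign_eq0 (R : pzRingType) (V : lmodType R) m (i j : 'I_m)
    (f : {perm 'I_m} -> V) : i != j -> (forall s, f (tperm i j * s)%g = f s) ->
  \sum_(s : {perm 'I_m}) (-1) ^+ s *: f s = 0.
Proof.
move=> ij ftau; rewrite (bigID (@odd_perm _)) /=.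
rewrite [X in X + _](reindex_inj (mulgI (tperm i j))) /=.
rewrite (eq_bigl (fun s : {perm 'I_m} => ~~ s)); last first.
  by move=> s; rewrite odd_mul_tperm ij.
rewrite -big_split big1 // => s _.
by rewrite ftau odd_mul_tperm ij /= signrN scaleNr addNr.
Qed.

Section MonomialExtension.
Context {k : fieldType} {n : nat} {V : lmodType {mpoly k[n]}}.
Variable f : 'X_{1..n} -> V.

(** The [k]-linear extension of [f] from monomials, where [k] acts on [V] through constant
    polynomials. *)
Definition monom_ext (p : {mpoly k[n]}) : V := \sum_(m <- msupp p) (p@_m)%:MP *: f m.

(** A range independent of the support allows the sums for different polynomials to be compared
    termwise. *)
Lemma monom_ext_widen d (p : {mpoly k[n]}) : (msize p <= d)%N ->
  monom_ext p = \sum_(m : 'X_{1..n < d}) (p@_m)%:MP *: f m.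
Proof.
move=> pd; pose I : subFinType _ := 'X_{1..n < d}.
rewrite /monom_ext (big_mksub I) //=; first last.
- by move=> x /msize_mdeg_lt /leq_trans; apply.
- by rewrite msupp_uniq.
by rewrite big_rmcond //= => i /memN_msupp_eq0 ->; rewrite mpolyC0 scale0r.
Qed.

Fact monom_ext_zmod_morphism : zmod_morphism monom_ext.
Proof.
move=> p q; have [d [pd qd pqd]] : exists d,
    [/\ msize p <= d, msize q <= d & msize (p - q) <= d]%N.
  by exists (maxn (msize p) (maxn (msize q) (msize (p - q)))); split; lia.
rewrite !(@monom_ext_widen d) // -sumrB; apply: eq_bigr => m _.
by rewrite mcoeffB mpolyCB scalerBl.
Qed.

HB.instance Definition _ :=
  GRing.isZmodMorphism.Build {mpoly k[n]} V monom_ext monom_ext_zmod_morphism.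

Lemma monom_extZ c p : monom_ext (c *: p) = c%:MP *: monom_ext p.
Proof.
have [d [pd cd]] : exists d, (msize p <= d /\ msize (c *: p) <= d)%N.
  by exists (maxn (msize p) (msize (c *: p))); split; lia.
rewrite !(@monom_ext_widen d) // scaler_sumr; apply: eq_bigr => m _.
by rewrite mcoeffZ mpolyCM scalerA.
Qed.

Lemma monom_extX m : monom_ext 'X_[m] = f m.
Proof. by rewrite /monom_ext msuppX big_seq1 mcoeffX eqxx mpolyC1 scale1r. Qed.

End MonomialExtension.

Section ChainResolution.
Context {k : fieldType} {n : nat}.
Variable G : seq 'X_{1..n}.
Local Notation S := {mpoly k[n]}.
Local Notation L := (lcm_lattice G).
Implicit Types (s : seq L) (m : 'X_{1..n}) (c : k) (i : nat).

(** The multidegree of a basis chain; the default [\bot] gives degree 0 to the empty chain. *)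
Definition top_monom s : 'X_{1..n} := ssval (head \bot%O s : L).

Lemma ssval_bot : ssval (\bot%O : L) = 0%MM.
Proof. by apply: big_pred0 => g; rewrite inE. Qed.

Lemma top_monom_nil : top_monom [::] = 0%MM.
Proof. exact: ssval_bot. Qed.

(** This is the largest lattice element that divides [m]. *)
Definition lcm_floor m : L := lcm_elt [set g : seq_sub G | (ssval g <= m)%MM].

Lemma lcm_floor_le m : (ssval (lcm_floor m) <= m)%MM.
Proof. by rewrite lem_lcm_of; apply/forall_inP => g; rewrite inE. Qed.

Lemma le_lcm_floor (x : L) m : (ssval x <= m)%MM -> (x <= lcm_floor m)%O.
Proof.
have [A ->] := lcm_eltP x => Am; rewrite /Order.le /= /lcm_le /= lem_lcm_of.
move: Am; rewrite /= lem_lcm_of => /forall_inP Am; apply/forall_inP => g gA.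
have := lepm_refl (lcm_of (G := G) [set g | (ssval g <= m)%MM]).
by rewrite lem_lcm_of => /forall_inP; apply; rewrite inE Am.
Qed.

Definition chain_tuple i : finType := {t : i.-tuple L | chain t}.

Definition seq_of_chain i (t : chain_tuple i) : seq L := val (val t).

Lemma chainP i (t : chain_tuple i) : chain (seq_of_chain t).
Proof. exact: valP t. Qed.

Lemma size_chain_tuple i (t : chain_tuple i) : size (seq_of_chain t) = i.
Proof. exact: size_tuple. Qed.

Lemma seq_of_chain_inj i : injective (@seq_of_chain i).
Proof. by move=> t u tu; apply/val_inj/val_inj. Qed.

Lemma chain_tuple_of s : chain s -> exists t : chain_tuple (size s), seq_of_chain t = s.
Proof. by move=> cs; exists (Sub (in_tuple s) cs). Qed.

Definition chain_mod i := {ffun chain_tuple i -> S^o}.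

(* This is [0] when [s] is not a strict chain of length [i]. *)
Definition chain_elt i s : chain_mod i := [ffun t => (seq_of_chain t == s)%:R].

Lemma chain_elt_tuple i (t : chain_tuple i) :
  chain_elt i (seq_of_chain t) = free_delta t.
Proof.
by apply/ffunP => u; rewrite [LHS]ffunE [RHS]ffunE (inj_eq (@seq_of_chain_inj i)).
Qed.

Lemma chain_elt_out i s : ~~ (chain s && (size s == i)) -> chain_elt i s = 0.
Proof.
move=> cs; apply/ffunP => t; rewrite !ffunE; case: (seq_of_chain t =P s) => [ts|//].
case/negP: cs.
by rewrite -ts chainP; apply/eqP/size_chain_tuple.
Qed.

(* The maps on chains are sealed because unification would otherwise unfold
   them down to polynomial arithmetic. *)
Fact chain_key : unit. Proof. exact: tt. Qed.

Definition chain_monom_def i m s : chain_mod i :=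
  ('X_[m - top_monom s] : S) *: chain_elt i s.

(* The element [s] moved to the multidegree [m]. *)
Definition chain_monom := locked_with chain_key chain_monom_def.

Lemma chain_monomE i m s :
  chain_monom i m s = ('X_[m - top_monom s] : S) *: chain_elt i s.
Proof. by rewrite /chain_monom locked_withE. Qed.

(** Each face is lifted to the multidegree of the whole chain; a face that keeps the top gets the
    monomial 1. *)
Definition chain_diff_def i : chain_mod i.+1 -> chain_mod i :=
  free_ext (fun t : chain_tuple i.+1 => let s := seq_of_chain t in
    \sum_(j < i.+1) (-1) ^+ j *: chain_monom i (top_monom s) (del j s)).

Definition chain_diff := locked_with chain_key chain_diff_def.

Fact chain_diff_linear i : linear (@chain_diff i).
Proof. by move=> a x y; rewrite /chain_diff locked_withE [LHS]linearP. Qed.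

HB.instance Definition _ i := GRing.isLinear.Build S (chain_mod i.+1) (chain_mod i)
  *:%R (@chain_diff i) (@chain_diff_linear i).

Lemma chain_diff_delta i (t : chain_tuple i.+1) :
  chain_diff (free_delta t) = \sum_(j < i.+1) (-1) ^+ j *:
    chain_monom i (top_monom (seq_of_chain t)) (del j (seq_of_chain t)).
Proof. by rewrite /chain_diff locked_withE [LHS]free_ext_delta. Qed.

Lemma le_top_del j s : chain s -> (top_monom (del j s) <= top_monom s)%MM.
Proof. by case: s => [_|x s /(le_head_del j)]; rewrite ?/del //= lepm_refl. Qed.

Lemma addmBBm (m m1 m2 : 'X_{1..n}) : (m2 <= m1)%MM -> (m1 <= m)%MM ->
  (m - m1 + (m1 - m2))%MM = (m - m2)%MM.
Proof.
move=> /mnm_lepP le21 /mnm_lepP le1; apply/mnmP => i; rewrite !mnmE.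
by have := le21 i; have := le1 i; lia.
Qed.

(** In a fixed multidegree the monomial factors combine, leaving the plain simplicial boundary. The
    bound on [top_monom s] is there because subtraction of exponents truncates. *)
Lemma chain_diff_monom i m s :
  chain s -> size s = i.+1 -> (top_monom s <= m)%MM ->
  chain_diff (chain_monom i.+1 m s)
    = \sum_(j < i.+1) (-1) ^+ j *: chain_monom i m (del j s).
Proof.
move=> cs ss sm; have [t] := chain_tuple_of cs; move: t; rewrite ss => t ts.
rewrite chain_monomE linearZ /= -ts chain_elt_tuple chain_diff_delta ts.
rewrite scaler_sumr; apply: eq_bigr => j _; rewrite 2!chain_monomE 3!scalerA mulrAC.
by rewrite -mpolyXD (addmBBm (le_top_del j cs) sm) mulrC.
Qed.

(** Over [k] the module is spanned by the chains moved to multidegrees above their own, which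
    reduces identities of [k]-linear maps to the homogeneous case. *)
Lemma chain_mod_ind i (P : chain_mod i -> Prop) : P 0 ->
    (forall x y, P x -> P y -> P (x + y)) ->
    (forall c m (t : chain_tuple i), (top_monom (seq_of_chain t) <= m)%MM ->
      P (c%:MP *: chain_monom i m (seq_of_chain t))) ->
  forall x, P x.
Proof.
move=> P0 PD Pm x; rewrite (free_deltaE x); apply: big_ind => // t _.
rewrite (mpolyE (x t)) scaler_suml; apply: big_ind => // a _.
rewrite -mul_mpolyC -scalerA -chain_elt_tuple.
suff -> : ('X_[a] : S) *: chain_elt i (seq_of_chain t)
    = chain_monom i (a + top_monom (seq_of_chain t))%MM (seq_of_chain t).
  by apply: Pm; apply: lem_addl.
by rewrite chain_monomE addmK.
Qed.

Lemma chain_diff_diff i (x : chain_mod i.+2) : chain_diff (chain_diff x) = 0.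
Proof.
elim/chain_mod_ind: x => [|x y dx dy|c m t tm]; first by rewrite !linear0.
  by rewrite !linearD /= dx dy addr0.
rewrite 2!linearZ /= (_ : chain_diff _ = 0) ?scaler0 //.
rewrite chain_diff_monom ?chainP ?size_chain_tuple // [LHS]linear_sum.
rewrite -[RHS](@boundary_boundary _ _ _ (chain_monom i m) i.+1 (seq_of_chain t)).
  apply: eq_bigr => j _; rewrite linearZ /= chain_diff_monom ?chain_del ?chainP //.
    by rewrite size_del size_chain_tuple.
  exact: lepm_trans (le_top_del _ (chainP t)) tm.
by rewrite size_chain_tuple.
Qed.

(** This is only [k]-linear: the new top depends on the multidegree of each term, the sum of its
    exponent and the degree of its chain. *)
Definition chain_htpy_def i (x : chain_mod i) : chain_mod i.+1 :=
  \sum_t monom_ext (fun a => let m := (a + top_monom (seq_of_chain t))%MM in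
    chain_monom i.+1 m (lcm_floor m :: seq_of_chain t)) (x t : S).

Definition chain_htpy := locked_with chain_key chain_htpy_def.

Lemma chain_htpyE i (x : chain_mod i) : chain_htpy x = chain_htpy_def x.
Proof. by rewrite /chain_htpy locked_withE. Qed.

Fact chain_htpy_zmod_morphism i : zmod_morphism (@chain_htpy i).
Proof.
move=> x y; rewrite !chain_htpyE -sumrB; apply: eq_bigr => t _.
by rewrite !ffunE raddfB.
Qed.

HB.instance Definition _ i := GRing.isZmodMorphism.Build (chain_mod i) (chain_mod i.+1)
  (@chain_htpy i) (@chain_htpy_zmod_morphism i).

Lemma chain_htpyZ i c (x : chain_mod i) :
  chain_htpy (c%:MP *: x) = c%:MP *: chain_htpy x.
Proof.
rewrite !chain_htpyE scaler_sumr; apply: eq_bigr => t _.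
by rewrite ffunE [_ *: _]mul_mpolyC monom_extZ.
Qed.

(** The bound is asked of genuine chains of length [i] only; for any other [s] both sides are
    zero. *)
Lemma chain_htpy_monom i m s : (chain s -> size s = i -> (top_monom s <= m)%MM) ->
  chain_htpy (chain_monom i m s) = chain_monom i.+1 m (lcm_floor m :: s).
Proof.
have [/andP[cs /eqP si] sm|cs _] := boolP (chain s && (size s == i)); last first.
  rewrite !chain_monomE !chain_elt_out ?scaler0 ?raddf0 //= chain_cons eqSS.
  by apply: contra cs => /andP[/andP[_ ->]].
have {}sm := sm cs si; have [t] := chain_tuple_of cs; move: t; rewrite si => t ts.
rewrite [X in chain_htpy X]chain_monomE chain_htpyE /chain_htpy_def.
rewrite (bigD1 t) //= big1 ?addr0; last first.
  move=> u ut; rewrite !ffunE -ts (inj_eq (@seq_of_chain_inj i)) (negPf ut) scaler0.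
  by rewrite raddf0.
rewrite !ffunE ts eqxx [_ *: _]mulr1 monom_extX.
by rewrite submK.
Qed.

Lemma chain_htpyP i (x : chain_mod i.+1) :
  chain_diff (chain_htpy x) + chain_htpy (chain_diff x) = x.
Proof.
elim/chain_mod_ind: x => [|x y IHx IHy|c m t tm].
- by rewrite !(linear0, raddf0) addr0.
- by rewrite !(linearD, raddfD) /= addrACA IHx IHy.
rewrite linearZ /= !chain_htpyZ linearZ /= -scalerDr; congr (_ *: _).
rewrite chain_htpy_monom // (chain_diff_monom (chainP t) (size_chain_tuple t) tm).
have ct := chainP t; have st := size_chain_tuple t.
rewrite [X in _ + X]raddf_sum /=.
have -> :
    \sum_(j < i.+1) chain_htpy ((-1) ^+ j *: chain_monom i m (del j (seq_of_chain t)))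
  = \sum_(j < i.+1) (-1) ^+ j *:
      chain_monom i.+1 m (lcm_floor m :: del j (seq_of_chain t)).
  apply: eq_bigr => j _; rewrite raddfZsign /= chain_htpy_monom // => _ _.
  exact: lepm_trans (le_top_del _ ct) tm.
move: (seq_of_chain t) tm ct st => [|q s] // tm ct st.
have qm : (q <= lcm_floor m)%O by apply: le_lcm_floor.
(* If the top [q] is already the floor, the cone over the chain is zero, and in the other term only
   the face omitting [q] survives, its cone restoring the chain. Otherwise the cone is a chain: its
   face omitting the floor is the original chain, and the rest cancels. *)
have [qE|nqE] := eqVneq q (lcm_floor m).
  rewrite -qE [X in chain_diff X]chain_monomE chain_elt_out; last first.
    by rewrite chain_cons /= ltxx.
  rewrite scaler0 linear0 add0r big_ord_recl expr0 scale1r del_cons0 big1 ?addr0 //.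
  move=> j _; rewrite chain_monomE chain_elt_out ?scaler0 //.
  by rewrite del_consS chain_cons /= ltxx.
rewrite chain_diff_monom /=; last first.
- exact: lcm_floor_le.
- by move: st => /= ->.
- by rewrite chain_cons ct andbT lt_neqAle nqE.
rewrite big_ord_recl expr0 scale1r del_cons0 -addrA -big_split big1 ?addr0 // => j _.
by rewrite /= del_consS exprS mulN1r scaleNr addNr.
Qed.

Lemma chain_exact i (x : chain_mod i.+1) :
  chain_diff x = 0 <-> exists y, chain_diff y = x.
Proof.
split=> [x0|[y <-]]; last exact: chain_diff_diff.
by exists (chain_htpy x); rewrite -[RHS]chain_htpyP x0 raddf0 addr0.
Qed.

Lemma chain_mod_eq0 (rk : L -> int) i (x : chain_mod i) : is_rank_function rk ->
  rk \top%O < i%:Z -> x = 0.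
Proof.
move=> rkP ri; apply/ffunP => t; have [mono _ _] := rkP.
have := size_chain rkP (chainP t); rewrite size_chain_tuple => it.
by have := le_lt_trans (le_trans it (mono _ _ (lex1 _))) ri; rewrite ltxx.
Qed.
End ChainResolution.

(** * The signed sum of flags and its boundary modulo the maximal ideal *)

Section FlagCycle.
Context {k : fieldType} {n : nat} {G : seq 'X_{1..n}}.
Local Notation L := (lcm_lattice G).
Context {rk : L -> int} {r : nat} {c : 'I_r.+1 -> L}.
Hypothesis rkP : is_rank_function rk.
Hypothesis rank_meets :
  forall A : {set 'I_r.+1}, rk (\meet_(i in A) c i)%O = r.+1%:Z - #|A|%:Z.

Definition flag_cycle : chain_mod (k := k) G r.+1 :=
  \sum_(s : {perm 'I_r.+1}) (-1) ^+ s *: chain_elt r.+1 (flag c s).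

Lemma flag_cycle_coef t : seq_of_chain t = flag c 1%g -> flag_cycle t = 1.
Proof.
move=> tE; rewrite sum_ffunE (bigD1 1%g) //= big1 ?addr0 => [|s s1].
  by rewrite !ffunE tE eqxx odd_perm1 scale1r.
rewrite !ffunE tE; case: eqP => [/esym/(flag_inj1 rkP rank_meets)/eqP|_].
  by rewrite (negPf s1).
by rewrite scaler0.
Qed.

Lemma top_monom_flag s : top_monom (flag c s) = ssval (\top%O : L).
Proof. by rewrite /top_monom /= /flag_elt big_pred0. Qed.

Lemma flag_cycle_diff t : ((chain_diff flag_cycle t) : {mpoly k[n]})@_0%MM = 0.
Proof.
have cf s := chain_flag rkP rank_meets s.
have elt s : chain_elt (k := k) r.+1 (flag c s)
    = chain_monom r.+1 (ssval (\top%O : L)) (flag c s).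
  rewrite chain_monomE top_monom_flag (_ : (_ - _ = 0)%MM) ?mpolyX0 ?scale1r //.
  by apply/mnmP => i; rewrite !mnmE subnn.
pose g j := \sum_(s : {perm 'I_r.+1}) (-1) ^+ s *:
  chain_monom (k := k) r (ssval (\top%O : L)) (del j (flag c s)).
have -> : chain_diff flag_cycle = \sum_(j < r.+1) (-1) ^+ j *: g j.
  rewrite [LHS]linear_sum.
  under eq_bigr => s _.
    rewrite linearZ /= elt chain_diff_monom ?cf ?size_mkseq ?top_monom_flag ?lepm_refl //.
    rewrite scaler_sumr; under eq_bigr => j _ do rewrite scalerA mulrC -scalerA.
    over.
  by rewrite exchange_big; apply: eq_bigr => j _; rewrite scaler_sumr.
(* Once the entry at position [j + 1] is deleted, swapping the coatoms at positions [j] and [j + 1]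
   does not change the flag. *)
have tail (j : 'I_r) : g (lift ord0 j) = 0.
  apply: (@sum_perm_sign_eq0 _ _ _ (widen_ord (leqnSn r) j) (lift ord0 j)).
    by rewrite -val_eqE /= /bump; lia.
  move=> s; congr (chain_monom _ _ _); apply: del_mkseq => i ir ij.
  exact: flag_elt_tperm.
rewrite big_ord_recl (eq_bigr (fun _ => 0)) => [|j _]; last by rewrite tail scaler0.
(* Only the faces omitting the top remain. Their monomial is nontrivial: exponent 0 would make the
   next entry equal to [\top], against strictness of the chain. *)
rewrite big1_eq addr0 expr0 scale1r /g sum_ffunE raddf_sum big1 // => s _.
rewrite ffunE chain_monomE ffunE; set a := (_ - _)%MM; set b := chain_elt _ _ _.
change (((-1) ^+ s * ('X_[a] * (b : {mpoly k[n]})))@_0%MM = 0).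
rewrite !(rmorphM (mcoeff 0%MM)) /= mcoeffX /a; case: eqP => [M0|_]; last first.
  by rewrite mul0r mulr0.
have := cf s; have := top_monom_flag s; move: (size_mkseq (flag_elt c s) r.+1) M0.
rewrite -/(flag c s); case: (flag c s) => // x s' _; rewrite del_cons0 => M0 xT.
rewrite chain_cons (_ : x = \top%O); last exact: val_inj.
have -> : head \bot%O s' = \top%O; last by rewrite ltxx.
apply/eqP; rewrite eq_le lex1 /=; apply/mnm_lepP => i.
by move/mnmP: M0 => /(_ i); rewrite !mnmE => /eqP; rewrite subn_eq0.
Qed.
End FlagCycle.

(** * The chain complex as a resolution of [S/I], and the lower bound on lengths *)

Section MonomialResolution.
Context {k : fieldType} {n : nat}.
Variable I : submodClosed ({mpoly k[n]}^o).
Hypothesis hI : monomial_ideal I.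
Local Notation S := {mpoly k[n]}.
Local Notation G := (min_generators I).
Local Notation L := (lcm_lattice G).

(** Descent on the degree: if [m] is not minimal, a proper divisor of it in [I] has smaller
    degree. *)
Lemma min_generator_below m : ('X_[m] : S) \in I ->
  exists2 g, g \in G & (g <= m)%MM.
Proof.
have [d] := ubnP (mdeg m); elim: d m => // d IH m md mI.
have [mG|] := pselect (min_generator I m).
  by exists m; [apply/mem_min_generators|apply: lepm_refl].
move=> /not_andP[//|/existsNP[m' /not_implyP[m'I /not_implyP[m'm ne]]]].
have [|g gG gm] := IH m' _ m'I; last by exists g => //; apply: lepm_trans gm m'm.
rewrite ltnS in md; apply: leq_trans md; rewrite -(submK m'm) mdegD.
rewrite -[X in (X < _)%N]add0n ltn_add2r lt0n mdeg_eq0; apply/eqP => mm'.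
by apply: ne; rewrite -(submK m'm) mm' add0m.
Qed.

Lemma monom_in_ideal (x : L) : x != \bot%O -> ('X_[ssval x] : S) \in I.
Proof.
have [A ->] := lcm_eltP x; have [->|[g gA] _] := set_0Vmem A; first by rewrite eqxx.
have gx : (ssval g <= lcm_of A)%MM.
  by have := lepm_refl (lcm_of A); rewrite lem_lcm_of => /forall_inP; apply.
rewrite /= -(submK gx) mpolyXD; apply: (@rpredZ _ _ I 'X_[_ - _] 'X_[ssval g]).
by have /mem_min_generators[] := ssvalP g.
Qed.

Hypothesis I1 : (1 : S) \notin I.

(** As [I] is proper, a minimal generator dividing [m] is not 1, and it lies below the floor. *)
Lemma lcm_floor_gt0 m : ('X_[m] : S) \in I -> (\bot < lcm_floor G m)%O.
Proof.
move=> /min_generator_below[g gG gm]; rewrite lt0x; apply/negP => /eqP f0.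
pose x : L := lcm_elt [set SeqSub gG].
have xE : ssval x = g by rewrite /= /lcm_of big_set1.
have : (x <= \bot)%O by rewrite -f0 le_lcm_floor ?xE.
rewrite lex0 => /eqP x0; move: xE; rewrite x0 ssval_bot => g0.
by have /mem_min_generators[] := gG; rewrite -g0 mpolyX0 (negPf I1).
Qed.

(** The empty chain is the only one of length 0, so this is the projection from [S] to [S/I]. *)
Definition chain_aug : chain_mod G 0 -> quot_module I :=
  free_ext (fun _ : chain_tuple G 0 => quot_pi I (1 : S)).

HB.instance Definition _ := GRing.Linear.on chain_aug.

Lemma chain0 : exists t : chain_tuple G 0, seq_of_chain t = [::] /\
  forall u, u = t.
Proof.
have [t tE] := @chain_tuple_of _ G [::] isT; exists t; split=> // u.
by apply: seq_of_chain_inj; rewrite tE; apply/nilP; rewrite /nilp size_chain_tuple.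
Qed.

Lemma chain_augE (x : chain_mod G 0) (t : chain_tuple G 0) :
  chain_aug x = quot_pi I (x t).
Proof.
have [t0 [_ uniq]] := chain0.
rewrite /chain_aug /free_ext (bigD1 t) //= big1 ?addr0; last first.
  by move=> u; rewrite (uniq u) (uniq t) eqxx.
by rewrite -linearZ /=; congr quot_pi; rewrite [_ *: _]mulr1.
Qed.

Lemma chain_aug_surj y : exists x, chain_aug x = y.
Proof.
have [t _] := chain0; exists [ffun=> repr y]; rewrite (chain_augE _ t) ffunE.
exact: quot_piK.
Qed.

Lemma chain_aug_exact x : chain_aug x = 0 <-> exists y, chain_diff y = x.
Proof.
have [t [tE uniq]] := chain0.
have aug0 z : chain_aug z = 0 <-> z t \in I.
  rewrite (chain_augE _ t) -(linear0 (quot_pi I)); split=> [/eqP|zI].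
    by rewrite eq_quot_pi subr0.
  by apply/eqP; rewrite eq_quot_pi subr0.
split=> [/aug0 xI|[y <-]].
  have -> : x = (x t : S) *: chain_elt 0 [::].
    by apply/ffunP => u; rewrite (uniq u) !ffunE tE eqxx [RHS]mulr1.
  have [M MP] := hI; have /MP[s sM ->] := xI.
  have MI g : M g -> ('X_[g] : S) \in I.
    move=> Mg; apply/MP; exists [:: (1, g)]; last by rewrite big_seq1 mul1r.
    by move=> a; rewrite inE => /eqP->.
  elim: s sM => [|a s IH] sM.
    by exists 0; rewrite linear0 big_nil scale0r.
  have [|y yE] := IH; first by move=> b bs; apply: sM; rewrite inE bs orbT.
  (* A monomial of [I] times the empty chain is the boundary of the one-element chain of its floor,
     moved to that multidegree. *)
  exists ((a.1 : S) *: chain_monom 1 a.2 [:: lcm_floor G a.2] + y).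
  rewrite linearD linearZ /= yE big_cons scalerDl -scalerA; congr (_ *: _ + _).
  have fl : chain [:: lcm_floor G a.2].
    by rewrite chain_cons /= andbT lcm_floor_gt0 //; apply/MI/sM/mem_head.
  rewrite (chain_diff_monom fl erefl (lcm_floor_le G a.2)).
  by rewrite big_ord1 expr0 scale1r del_cons0 chain_monomE top_monom_nil subm0.
elim/(@chain_mod_ind k): y => [|y z y0 z0|c m u um]; first by rewrite !linear0.
  by rewrite !linearD /= y0 z0 addr0.
rewrite 2!linearZ /= (_ : chain_aug _ = 0) ?scaler0 //.
rewrite chain_diff_monom ?chainP ?size_chain_tuple //; apply/aug0.
have := chainP u; have := size_chain_tuple u; case: (seq_of_chain u) um => [|q [|]] //.
move=> qm _; rewrite chain_cons /= andbT => q0.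
rewrite big_ord1 expr0 scale1r del_cons0 chain_monomE !ffunE tE eqxx [_ *: _]mulr1.
rewrite top_monom_nil subm0 -(submK qm) mpolyXD.
apply: (@rpredZ _ _ I 'X_[_ - _] 'X_[_]).
by apply: monom_in_ideal; rewrite -lt0x.
Qed.

Lemma chain_resolution (rk : L -> int) (r : nat) :
  is_rank_function rk -> rk \top%O = r%:Z ->
  has_projective_resolution (quot_module I) r.
Proof.
move=> rkP rE; exists (chain_mod G), chain_aug, (fun i => @chain_diff k n G i); split.
- by move=> i; apply: projective_free.
- by move=> i ri x; apply: chain_mod_eq0 rkP _; rewrite rE ltz_nat.
- exact: chain_aug_surj.
- exact: chain_aug_exact.
- exact: chain_exact.
Qed.

Lemma rank_le_resolution (rk : L -> int) (r l : nat) (c : 'I_r -> L) :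
  is_rank_function rk -> rk \top%O = r%:Z ->
  (forall A : {set 'I_r}, rk (\meet_(i in A) c i)%O = r%:Z - #|A|%:Z) ->
  has_projective_resolution (quot_module I) l -> (r <= l)%N.
Proof.
case: r c => // r c rkP rE rkc [P [eps [d [projP P0 epsP d0P dP]]]].
rewrite leqNgt; apply/negP => lr.
(* The rank is [r.+1], so there are no chains of length [r.+2], and exactness makes this
   differential injective. *)
have inj : injective (@chain_diff k n G r).
  apply: raddf_inj => x /chain_exact[y <-].
  by rewrite (@chain_mod_eq0 k n G rk _ y) ?linear0 // rE ltz_nat.
have [s sP] := differential_split (fun i => @projective_free S _) projP
  chain_aug_surj epsP chain_aug_exact d0P (@chain_exact k n G) dP (P0 _ lr) inj.
have [t tE] := chain_tuple_of (chain_flag rkP rkc 1%g).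
move: t tE; rewrite size_mkseq => t tE.
have := flag_cycle_diff (k := k) rkP rkc; have := flag_cycle_coef (k := k) rkP rkc tE.
move: flag_cycle => z zt zd.
have : ((z t : S)@_0%MM) = 1 by rewrite zt mcoeff1 eqxx.
have sz : s (chain_diff z) = z := sP z.
(* By [S]-linearity [s (chain_diff z)] is a combination with the coefficients of [chain_diff z],
   whose constant terms vanish; this contradicts the coefficient 1 of [z]. *)
rewrite -sz (free_deltaE (chain_diff z)) linear_sum sum_ffunE raddf_sum.
rewrite big1 => [/esym/eqP|u _]; first by rewrite oner_eq0.
rewrite linearZ ffunE; set a := chain_diff z u; set b := s _ t.
change (((a : S) * (b : S))@_0%MM = 0).
by rewrite (rmorphM (mcoeff 0%MM)) /= zd mul0r.
Qed.

End MonomialResolution.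

(** * The unit ideal and the computation of the projective dimension *)

Lemma unit_ideal_resolution (k : fieldType) (n : nat)
    (I : submodClosed ({mpoly k[n]}^o)) : (1 : {mpoly k[n]}) \in I ->
  has_projective_resolution (quot_module I) 0.
Proof.
move=> I1; have q0 (y : quot_module I) : y = 0.
  rewrite -(quot_piK y) -(linear0 (quot_pi I)); apply/eqP.
  rewrite eq_quot_pi subr0 -[repr y]mulr1.
  exact: (@rpredZ _ _ I (repr y) 1).
pose V := {ffun void -> {mpoly k[n]}^o}; have V0 (x : V) : x = 0 by apply/ffunP => -[].
exists (fun=> V), (\0 : {linear _ -> _}), (fun=> (\0 : {linear _ -> _})); split.
- by move=> _; apply: projective_free.
- by move=> i _ x; apply: V0.
- by move=> y; exists 0; rewrite (q0 y).
- by move=> x; split=> _ //; exists 0; rewrite (V0 x).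
- by move=> i x; split=> _ //; exists 0; rewrite (V0 x).
Qed.

Lemma unit_ideal_top (k : fieldType) (n : nat)
    (I : submodClosed ({mpoly k[n]}^o)) : (1 : {mpoly k[n]}) \in I ->
  \top%O = \bot%O :> LCM_lattice I.
Proof.
move=> I1; apply/eqP; rewrite -lex0 /Order.le /= /lcm_le lem_lcm_of.
apply/forall_inP => g _; have /mem_min_generators[_ gmin] := ssvalP g.
rewrite -(gmin 0%MM) ?mpolyX0 //; by apply/mnm_lepP => i; rewrite mnm0E.
Qed.

Lemma proj_dim_eq (R : pzRingType) (M : lmodType R) (r : nat) :
  has_projective_resolution M r ->
  (forall l, has_projective_resolution M l -> (r <= l)%N) -> proj_dim M = Some r.
Proof.
move=> Mr min; rewrite /proj_dim; case: pselect => [ex|[]]; last first.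
  by exists r; apply/asboolP.
case: ex_minnP => l /asboolP /min rl /(_ r) lr; congr Some.
by apply/eqP; rewrite eqn_leq rl lr //; apply/asboolP.
Qed.

Theorem corollary5p2 (k : fieldType) (n : nat)
    (I : submodClosed ({mpoly k[n]}^o)) (hI : monomial_ideal I)
    (hsm : lower_semimodular (LCM_lattice I))
    (hco : coatomic (LCM_lattice I)) :
  omap Posz (proj_dim (quot_module I)) = Some (lattice_rank (LCM_lattice I)).
Proof.
have [rk rkP rk_sm] := hsm; rewrite (lattice_rankE rkP).
(* For [I = S] the lattice is a single point and only the empty chain exists, so the chain complex
   would resolve [S] instead of the zero module. *)
have [I1|I1] := boolP ((1 : {mpoly k[n]}) \in I).
  have [_ rk0 _] := rkP; rewrite unit_ideal_top // rk0.
  by rewrite (proj_dim_eq (unit_ideal_resolution I1)).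
have [r [c [rE rkc]]] := exists_coatom_basis rkP rk_sm hco.
rewrite rE (@proj_dim_eq _ _ r) //; first exact: chain_resolution rkP rE.
by move=> l; apply: rank_le_resolution rkP rE rkc.
Qed.
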